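(* Let $\phi:[0,1]\to[0,\infty)$ be a regular gauge function, let $\mathcal{D}_\phi=\bigcup_j\mathcal{D}_{n_j}$ be a $\phi$-dyadic grid, and let $\mu$ be a finite positive measure on $\partial\mathbb{D}$. Suppose that there exists a constant $C>0$ so that for any offset (integer) $j_0\ge0$, one can decompose $\mu$ into a countable sum $\mu=\sum_{j=1}^\infty\mu_j$ of positive measures such that, for each $j$, $\mu_j(I)\le C\phi(|I|)$ for any $I\in\mathcal{D}_{n_{j+j_0}}$. Then $\mu$ does not charge $\phi$-Beurling-Carleson sets, i.e. $\mu(E)=0$ for every $\phi$-Beurling-Carleson set $E$.
   Context: Lengths $|\cdot|$ of arcs of the unit circle $\partial\mathbb{D}$ are normalized so that $|\partial\mathbb{D}|=1$. A function $\phi:[0,1]\to[0,\infty)$ is a regular gauge function if: (G1) $\phi(t)=t\,\phi_1(t)=t\int_t^1\frac{ds}{\lambda(s)}$, where $\lambda$ is a non-negative function with $\int_0^1\frac{ds}{\lambda(s)}=\infty$; (G2) $\lambda(\theta t)\asymp\lambda(t)$ for $\theta\in[1,2]$ (doubling, with uniform implicit constants); (G3) there is a constant $C_0>0$ such that $\sum_{k=0}^\infty\phi(2^{-k}t)\le C_0\,\phi(t)$ for $t\in[0,1/2]$. A closed set $E\subset\partial\mathbb{D}$ of zero length is a $\phi$-Beurling-Carleson set if $\sum_k\phi(|J_k|)<\infty$, where $\{J_k\}$ are the complementary arcs of $E$. For $n\ge0$, $\mathcal{D}_n$ is the collection of the $2^n$ half-open dyadic arcs $\{z\in\partial\mathbb{D}: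 k2^{-n}2\pi\le\arg z<(k+1)2^{-n}2\pi\}$, $k=0,\dots,2^n-1$, so $|I|=2^{-n}$ for $I\in\mathcal{D}_n$. A $\phi$-dyadic grid is a collection $\mathcal{D}_\phi=\bigcup_{j\ge1}\mathcal{D}_{n_j}$, where the increasing sequence of positive integers $\{n_j\}_{j\ge1}$ satisfies $$\int_{2^{-n_{j+1}}}^{2^{-n_j}}\frac{dt}{\lambda(t)}\asymp\int_{2^{-n_j}}^1\frac{dt}{\lambda(t)}=\phi_1(2^{-n_j}),\qquad j=1,2,\dots,$$ with implicit constants independent of $j$. *)

(* Defs.v *)
From HB Require Import structures.
From mathcomp Require Import all_boot all_order all_algebra.
From mathcomp Require Import all_classical all_reals all_analysis.

Set Implicit Arguments.
Unset Strict Implicit.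
Unset Printing Implicit Defensive.

Import Order.TTheory GRing.Theory Num.Theory.
Import numFieldNormedType.Exports.

Local Open Scope classical_set_scope.
Local Open Scope ring_scope.

Section Circle.
Variable R : realType.

Definition unit_circle : set (R * R) :=
  [set z | z.1 ^+ 2 + z.2 ^+ 2 = 1].

Lemma unit_circle_expi (t : R) : (cos t, sin t) \in unit_circle.
Proof. by rewrite inE /unit_circle /= cos2Dsin2. Qed.

(* The topology is the subspace topology inherited from the plane. *)
Definition circle : Type := set_type unit_circle.

Definition expi (t : R) : circle := SigSub (unit_circle_expi t).

HB.instance Definition _ := Topological.on circle.
HB.instance Definition _ := isPointed.Build circle (expi 0).

(* The sigma-algebra is the Borel one. *)
HB.instance Definition _ :=
  Measurable.copy circle (g_sigma_algebraType (@open circle)).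

(* The angle is 2 pi t with t in [0, 1), so that the circle has length 1. *)
Definition arc_length (A : set circle) : \bar R :=
  lebesgue_measure [set t : R | 0 <= t < 1 /\ A (expi (2 * pi * t))].

(* {z : 2 pi k 2^-n <= arg z < 2 pi (k+1) 2^-n} *)
Definition dyadic_arc (n k : nat) : set circle :=
  [set expi t | t in
    [set t : R | k%:R * 2 ^- n * (2 * pi) <= t < k.+1%:R * 2 ^- n * (2 * pi)]].

Definition dyadic_arcs (n : nat) : set (set circle) :=
  [set dyadic_arc n k | k in [set k | (k < 2 ^ n)%N]].

Definition complementary_arcs (E : set circle) : set (set circle) :=
  [set connected_component (~` E) z | z in ~` E].

End Circle.

Section Gauge.
Variable R : realType.

(* The inverse is taken in the extended reals: 1 / 0 = +oo. *)
Definition int_inv (lambda : R -> R) (a b : R) : \bar R :=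
  (\int[lebesgue_measure]_(s in `]a, b]) ((lambda s)%:E)^-1)%E.

Definition phi1 (lambda : R -> R) (t : R) : \bar R := int_inv lambda t 1.

(* Functions on [0, 1] and ]0, 1] are total functions on R of which only the
   values on these intervals matter.  At t = 0 the equation in G1 reads
   phi 0 = 0 * +oo = 0. *)
Record regular_gauge (phi lambda : R -> R) : Prop := RegularGauge {
  gauge_ge0 : forall t : R, 0 <= t <= 1 -> 0 <= phi t;
  gauge_lambda_ge0 : forall t : R, 0 < t <= 1 -> 0 <= lambda t;
  gauge_lambda_measurable : measurable_fun (`]0, 1] : set R) lambda;
  gauge_G1 : forall t : R, 0 <= t <= 1 ->
    (phi t)%:E = (t%:E * phi1 lambda t)%E;
  gauge_G1_infty : int_inv lambda 0 1 = +oo%E;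
  gauge_G2 : exists c1 c2 : R, [/\ 0 < c1, 0 < c2 &
    forall t theta : R, 0 < t -> 1 <= theta <= 2 -> theta * t <= 1 ->
      c1 * lambda t <= lambda (theta * t) <= c2 * lambda t];
  gauge_G3 : exists2 C0 : R, 0 < C0 & forall t : R, 0 <= t <= 1 / 2 ->
    (\sum_(0 <= k <oo) (phi (2 ^- k * t))%:E <= (C0 * phi t)%:E)%E
}.

Definition beurling_carleson (phi : R -> R) (E : set (circle R)) : Prop :=
  [/\ closed E, arc_length E = 0%E &
    (\esum_(J in complementary_arcs E) (phi (fine (arc_length J)))%:E
      < +oo)%E].

(* The grid is given by its sequence of generations n 1 < n 2 < ...; the value
   n 0 is irrelevant. *)
Definition dyadic_grid (lambda : R -> R) (n : nat -> nat) : Prop :=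
  [/\ forall j, (1 <= j)%N -> (0 < n j)%N,
      forall j, (1 <= j)%N -> (n j < n j.+1)%N &
      exists c1 c2 : R, [/\ 0 < c1, 0 < c2 & forall j, (1 <= j)%N ->
        (c1%:E * phi1 lambda (2 ^- n j)
           <= int_inv lambda (2 ^- n j.+1) (2 ^- n j)
           <= c2%:E * phi1 lambda (2 ^- n j))%E]].

End Gauge.

(* Main.v *)
Require Import Defs.
From HB Require Import structures.
From mathcomp Require Import all_boot all_order all_algebra.
From mathcomp Require Import all_classical all_reals all_analysis.
From mathcomp Require Import measurable_realfun lra ring.

Set Implicit Arguments.
Unset Strict Implicit.
Unset Printing Implicit Defensive.

Import Order.TTheory GRing.Theory Num.Theory.
Import numFieldNormedType.Exports.

Local Open Scope classical_set_scope.
Local Open Scope ring_scope.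

(** Let N(m) be the number of dyadic arcs of generation m that meet E.  The part
mu_j of the decomposition with offset j0 is controlled on the arcs of generation
n (j + j0), so mu_j E <= C a (j + j0) with a j = N(n j) phi(2^-(n j)), and mu E is
at most C times the sum of a j over j > j0.  Everything thus reduces to the
convergence of the series of the a j ([sum_nb_meets_lty]): the offset is
arbitrary, and the tails of a convergent series tend to zero.

Convergence is a geometric fact about E.  As E has zero length, the N(m) dyadic
arcs that meet E have their length N(m) 2^-m covered by their traces on the
complementary arcs J of E.  A connected set J disjoint from E meets at most two
dyadic arcs of each generation that also meet E, because such arcs lie at the two
ends of J ([no_three_dyadic_arcs]).  Hence N(m) 2^-m is at most the sum over J of
min(|J|, 2 2^-m) ([nb_meets_le]).  Multiply by phi1(2^-m), put m = n j, and
exchange the sums over j and J: it remains to bound, for an arc of length l, the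
sum over j of min(l, 2 2^-(n j)) phi1(2^-(n j)) by a multiple of phi(l), up to a
multiple of l, which is harmless since the arcs have total length at most 1
([arc_sum]).  For the scales coarser than l, the grid condition makes
phi1(2^-(n j)) grow geometrically, so that the sum is comparable to its last
term, at most l phi1(l) = phi(l) ([coarse_sum]).  For the finer scales the sum is
at most that of phi(2^-i) over all i with 2^-i < l, which G3 bounds by phi(l)
([fine_sum]).

The circle is handled through the angle t in [0, 1) measured in turns.  Lengths
are then Lebesgue measures of subsets of [0, 1), dyadic arcs are dyadic
intervals, and the only topology needed is that an arc and its complement are
images of intervals under the continuous map [turn]. *)

(** * The circle as a quotient of the line *)

Section CircleGeometry.
Context {R : realType}.
Implicit Types (a b t x y : R) (z : circle R).

Definition turn (t : R) : circle R := expi (2 * pi * t).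

Lemma circle_eq z z' : val z = val z' -> z = z'.
Proof. exact: val_inj. Qed.

Lemma val_turn t : val (turn t) = (cos (2 * pi * t), sin (2 * pi * t)).
Proof. by []. Qed.

Lemma turn_continuous : continuous turn.
Proof.
apply: (@continuous_comp_initial _ _ _ (val : circle R -> R * R) turn) => t.
have c2 : {for t, continuous (fun t : R => 2 * pi * t)} by exact: mulrl_continuous.
have ccos : cos (2 * pi * u) @[u --> t] --> cos (2 * pi * t).
  exact: (continuous_comp c2 (@continuous_cos _ _)).
have csin : sin (2 * pi * u) @[u --> t] --> sin (2 * pi * t).
  exact: (continuous_comp c2 (@continuous_sin _ _)).
exact: cvg_pair ccos csin.
Qed.

Lemma circle_hausdorff : hausdorff_space (circle R).
Proof.
have hR2 : hausdorff_space (R * R)%type by exact: norm_hausdorff.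
move=> p q cl; apply: circle_eq; apply: hR2 => A B nA nB.
have cv : continuous (val : circle R -> R * R) by exact: initial_continuous.
have [z [Az Bz]] := cl _ _ (cv p A nA) (cv q B nB).
by exists (val z).
Qed.

Lemma turnD1 t : turn (t + 1) = turn t.
Proof.
apply: circle_eq; rewrite !val_turn mulrDr mulr1 [X in _ + X]mulr_natl.
by rewrite cosD2pi sinD2pi.
Qed.

(** The cosine of the difference of two angles with the same image is 1, so the
sine of half the difference vanishes. *)
Lemma turn_inj x y : turn x = turn y -> `|x - y| < 1 -> x = y.
Proof.
wlog yx : x y / y <= x => [wlg|].
  case: (leP y x) => [|/ltW] xy; first exact: wlg.
  by rewrite distrC => /esym eqt xy1; apply/esym; exact: wlg.
move=> /(congr1 val); rewrite !val_turn => -[ecos esin].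
rewrite ger0_norm ?subr_ge0// => xy1; apply/eqP; rewrite eq_le yx andbT leNgt.
apply/negP => ltyx.
have : cos ((pi * (x - y)) *+ 2) = 1.
  have -> : (pi * (x - y)) *+ 2 = 2 * pi * x - 2 * pi * y by ring.
  by rewrite cosB ecos esin -!expr2 cos2Dsin2.
have sin0 : 0 < sin (pi * (x - y)).
  apply: sin_gt0_pi; have := pi_gt0 R; nra.
rewrite cos_mulr2n => cos1.
have := cos2Dsin2 (pi * (x - y)).
have : 0 < sin (pi * (x - y)) ^+ 2 by rewrite exprn_gt0.
lra.
Qed.

Lemma turn_surj z : exists2 t, 0 <= t < 1 & turn t = z.
Proof.
case: z => -[a b] zS.
have ab1 : a ^+ 2 + b ^+ 2 = 1 by have := zS; rewrite inE.
have pi0 := pi_gt0 R.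
have a1 : -1 <= a <= 1 by nra.
have a11 : a \in `[-1, 1] by rewrite in_itv.
have t0 := acos_ge0 a1; have tpi := acos_lepi a1.
have sint : sin (acos a) = `|b|.
  by rewrite sin_acos// -sqrtr_sqr; congr Num.sqrt; lra.
have scale (u : R) : 2 * pi * (u / (2 * pi)) = u.
  by rewrite mulrC divfK// mulf_neq0// gt_eqF.
case: (leP 0 b) => b0.
  exists (acos a / (2 * pi)).
    apply/andP; split; first by rewrite divr_ge0 ?mulr_ge0 ?(ltW pi0).
    by rewrite ltr_pdivrMr ?mulr_gt0//; lra.
  apply: circle_eq; rewrite val_turn /= scale acosK// sint.
  by rewrite ger0_norm.
have t0' : 0 < acos a by apply: acos_gt0; nra.
exists (1 - acos a / (2 * pi)).
  rewrite subr_ge0 ltrBlDr ltrDl divr_gt0 ?mulr_gt0// andbT.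
  by rewrite ler_pdivrMr ?mulr_gt0//; lra.
apply: circle_eq; rewrite val_turn /= mulrBr scale mulr1.
have -> : 2 * pi - acos a = - acos a + pi *+ 2 by rewrite mulr_natl addrC.
rewrite cosD2pi sinD2pi cosN sinN acosK// sint.
by rewrite ltr0_norm// opprK.
Qed.

Lemma closed_turn_itv a b : closed (turn @` `[a, b]).
Proof.
apply: compact_closed; first exact: circle_hausdorff.
apply: continuous_compact; last exact: segment_compact.
by apply: continuous_subspaceT => t; exact: turn_continuous.
Qed.

(** The complement is the compact arc that goes round the other way, from b - 1
to a. *)
Lemma open_turn_itv a b : 0 <= a -> a < b -> b <= 1 -> open (turn @` `]a, b[).
Proof.
move=> a0 ab b1; rewrite -[turn @` _]setCK openC.
suff -> : ~` (turn @` `]a, b[) = turn @` `[b - 1, a].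
  exact: closed_turn_itv.
apply/seteqP; split=> z /=; last first.
  move=> [t]; rewrite in_itv/= => /andP[bt ta] <- [t'].
  rewrite in_itv/= => /andP[at' t'b].
  by move=> /turn_inj; rewrite ger0_norm; [move=> /(_ _)|]; lra.
have [t /andP[t0 t1] <-] := turn_surj z; move=> nab.
case: (leP t a) => ta; first by exists t => //; rewrite in_itv/=; lra.
exists (t - 1); last by rewrite -turnD1 subrK.
have bt : b <= t.
  by rewrite leNgt; apply/negP => tb; apply: nab; exists t => //; rewrite in_itv/= ta.
by rewrite in_itv/=; lra.
Qed.

(** An open arc is relatively clopen in the circle minus its two endpoints, so a
connected set that avoids the endpoints and enters the arc stays in it. *)
Lemma connected_turn_itv (J : set (circle R)) a b p t :
  connected J -> 0 <= a -> b < 1 -> ~ J (turn a) -> ~ J (turn b) ->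
  a < p < b -> J (turn p) -> 0 <= t < 1 -> J (turn t) -> a < t < b.
Proof.
move=> Jconn a0 b1 Ja Jb /andP[ap pb] Jp /andP[t0 t1] Jt.
have ab : a < b by exact: lt_trans pb.
have /seteqP[_ JI] : J `&` turn @` `]a, b[ = J.
  apply: Jconn.
  - by exists (turn p); split=> //; exists p => //; rewrite /= in_itv/= ap.
  - by exists (turn @` `]a, b[) => //; apply: open_turn_itv => //; exact: ltW.
  - exists (turn @` `[a, b]); first exact: closed_turn_itv.
    apply/seteqP; split=> z [Jz [s /=]]; rewrite in_itv/= => /andP[as_ sb] sz.
      by split=> //; exists s => //; rewrite in_itv/= !ltW.
    split=> //; exists s => //; rewrite /= in_itv/= !lt_neqAle as_ sb !andbT.
    apply/andP; split; apply/eqP => E; first by apply: Ja; rewrite E sz.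
    by apply: Jb; rewrite -E sz.
have [_ [s /=]] := JI _ Jt; rewrite in_itv/= => /andP[as_ sb] /turn_inj st.
by rewrite -st ?as_// ltr_norml; lra.
Qed.

End CircleGeometry.

(** * Dyadic arcs *)

Section DyadicArcs.
Context {R : realType}.
Implicit Types (m k : nat) (t : R).

Definition dyadic_itv (m k : nat) : set R :=
  `[k%:R * 2 ^- m, k.+1%:R * 2 ^- m[.

Lemma dyadic_itvP m k t :
  dyadic_itv m k t <-> k%:R * 2 ^- m <= t < k.+1%:R * 2 ^- m.
Proof. by rewrite /dyadic_itv/= in_itv. Qed.

Lemma dyadic_arcE m k : @dyadic_arc R m k = turn @` dyadic_itv m k.
Proof.
have pi2 : 0 < 2 * pi :> R by rewrite mulr_gt0 ?pi_gt0.
apply/seteqP; split=> z [t /=].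
  rewrite -ler_pdivlMr// -ltr_pdivrMr// => tk <-.
  exists (t / (2 * pi)); first exact/dyadic_itvP.
  by rewrite /turn [2 * pi * (t / _)]mulrC divfK// gt_eqF.
move=> /dyadic_itvP tk <-; exists (2 * pi * t) => //=.
by rewrite [2 * pi * t]mulrC ler_pM2r// ltr_pM2r.
Qed.

(** A half-open arc is an increasing union of compact arcs. *)
Lemma measurable_dyadic_arc m k : measurable (@dyadic_arc R m k).
Proof.
rewrite dyadic_arcE.
suff -> : turn @` dyadic_itv m k = \bigcup_i
    turn @` `[k%:R * 2 ^- m : R, k.+1%:R * 2 ^- m - i.+1%:R^-1].
  apply: bigcupT_measurable => i; rewrite -[X in measurable X]setCK.
  apply: measurableC; apply: sub_sigma_algebra.
  exact/closed_openC/closed_turn_itv.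
apply/seteqP; split=> z.
  move=> [t /dyadic_itvP/andP[kt tk] <-].
  (* 1 / (i + 1) is below the distance e to the excluded endpoint. *)
  pose e := k.+1%:R * 2 ^- m - t.
  have e0 : 0 < e by rewrite subr_gt0.
  exists (Num.bound e^-1) => //; exists t => //; rewrite /= in_itv/= kt/=.
  rewrite lerBrDl -lerBrDr -/e invf_ple ?posrE//.
  have /ltW eb : e^-1 < (Num.bound e^-1)%:R.
    by apply: archi_boundP; rewrite invr_ge0 ltW.
  by apply: le_trans eb _; rewrite ler_nat.
move=> [i _ [t /=]]; rewrite in_itv/= => /andP[kt tk] <-.
exists t => //; apply/dyadic_itvP; rewrite kt/=.
by apply: le_lt_trans tk _; rewrite ltrBlDr ltrDl invr_gt0.
Qed.

Lemma dyadic_itv_sub01 m k t : (k < 2 ^ m)%N -> dyadic_itv m k t -> 0 <= t < 1.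
Proof.
move=> km /dyadic_itvP /andP[kt tk]; rewrite (le_trans _ kt) ?mulr_ge0//=.
apply: lt_le_trans tk _; rewrite ler_pdivrMr ?exprn_gt0// mul1r -natrX ler_nat//.
Qed.

Definition unwrap (A : set (circle R)) : set R :=
  [set t | 0 <= t < 1 /\ A (turn t)].

Lemma arc_lengthE A : arc_length A = lebesgue_measure (unwrap A).
Proof. by []. Qed.

Lemma lebesgue_dyadic_itv m k :
  lebesgue_measure (dyadic_itv m k) = (2 ^- m)%:E.
Proof.
rewrite /dyadic_itv lebesgue_measure_itv/= lte_fin ltr_pM2r ?invr_gt0 ?exprn_gt0//.
by rewrite ltr_nat leqnn -EFinD -mulrBl -natrB// subSnn mul1r.
Qed.

Lemma arc_length_dyadic m k : (k < 2 ^ m)%N ->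
  arc_length (@dyadic_arc R m k) = (2 ^- m)%:E.
Proof.
move=> km; rewrite arc_lengthE -(lebesgue_dyadic_itv m k); congr lebesgue_measure.
apply/seteqP; split=> [t [/andP[t0 t1]]|t tk].
  rewrite dyadic_arcE => -[s sk]; have /andP[s0 s1] := dyadic_itv_sub01 km sk.
  by move=> /turn_inj <-//; rewrite ltr_norml; lra.
split; first exact: dyadic_itv_sub01 tk.
by rewrite dyadic_arcE; exists t.
Qed.

Lemma dyadic_itv_lt m j k s t : (j < k)%N ->
  dyadic_itv m j s -> dyadic_itv m k t -> s < t.
Proof.
move=> jk /dyadic_itvP/andP[_ sj] /dyadic_itvP/andP[kt _].
apply: lt_le_trans sj _; apply: le_trans kt.
by rewrite ler_pM2r ?invr_gt0 ?exprn_gt0// ler_nat.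
Qed.

Lemma dyadic_cover m z : exists2 k, (k < 2 ^ m)%N & @dyadic_arc R m k z.
Proof.
have [t /andP[t0 t1] <-] := turn_surj z.
have p0 : 0 < 2 ^+ m :> R by rewrite exprn_gt0.
have tm0 : 0 <= t * 2 ^+ m by rewrite mulr_ge0 ?(ltW p0).
have /andP[kt tk] := truncn_itv tm0.
exists (Num.truncn (t * 2 ^+ m)).
  by rewrite -(ltr_nat R) natrX (le_lt_trans kt)// gtr_pMl.
rewrite dyadic_arcE; exists t => //; apply/dyadic_itvP.
by rewrite ler_pdivrMr// ltr_pdivlMr// kt.
Qed.

(** If three dyadic arcs met both J and its complement, the points of the complement
would cut the circle into three arcs, one of which contains J, and which misses one
of the three dyadic arcs.  The functions p and q select in each dyadic interval a
point of J and one outside J. *)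
Lemma no_three_dyadic_arcs m (J : set (circle R)) (k1 k2 k3 : nat)
    (p q : nat -> R) : connected J ->
  (k1 < k2)%N -> (k2 < k3)%N -> (k3 < 2 ^ m)%N ->
  (forall k, k \in [:: k1; k2; k3] ->
    [/\ dyadic_itv m k (p k), J (turn (p k)), dyadic_itv m k (q k) &
     ~ J (turn (q k))]) ->
  False.
Proof.
move=> Jconn k12 k23 k3m pq.
have [p1 Jp1 q1 Jq1] := pq k1 ltac:(by rewrite !inE eqxx).
have [p2 Jp2 q2 Jq2] := pq k2 ltac:(by rewrite !inE eqxx orbT).
have [p3 Jp3 q3 Jq3] := pq k3 ltac:(by rewrite !inE eqxx !orbT).
have k13 := ltn_trans k12 k23.
have k2m := ltn_trans k23 k3m; have k1m := ltn_trans k12 k2m.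
have /andP[q10 _] := dyadic_itv_sub01 k1m q1.
have /andP[q20 q21] := dyadic_itv_sub01 k2m q2.
have /andP[_ q31] := dyadic_itv_sub01 k3m q3.
have p1q2 := dyadic_itv_lt k12 p1 q2; have q1p2 := dyadic_itv_lt k12 q1 p2.
have p2q3 := dyadic_itv_lt k23 p2 q3; have q2p3 := dyadic_itv_lt k23 q2 p3.
case: (ltgtP (p k2) (q k2)) => [pq2|qp2|E]; last by apply: Jq2; rewrite -E.
  have := connected_turn_itv Jconn q10 q21 Jq1 Jq2 _ Jp2 (dyadic_itv_sub01 k3m p3) Jp3.
  by rewrite q1p2 pq2 => /(_ isT); rewrite (ltNge (p k3)) (ltW q2p3) andbF.
have := connected_turn_itv Jconn q20 q31 Jq2 Jq3 _ Jp2 (dyadic_itv_sub01 k1m p1) Jp1.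
by rewrite p2q3 qp2 => /(_ isT); rewrite (ltNge (q k2)) (ltW p1q2).
Qed.

End DyadicArcs.

(** * Complementary arcs *)

Section ComplementaryArcs.
Context {R : realType} (E : set (circle R)).
Context (E_closed : closed E).

Local Notation leb := (@lebesgue_measure R).

Lemma complementary_arc_connected J : complementary_arcs E J -> connected J.
Proof. by move=> [z _ <-]; exact: component_connected. Qed.

Lemma complementary_arc_sub J : complementary_arcs E J -> J `<=` ~` E.
Proof. by move=> [z _ <-]; exact: connected_component_sub. Qed.

Lemma complementary_arcE J z : complementary_arcs E J -> J z ->
  J = connected_component (~` E) z.
Proof. by move=> [w _ <-]; exact: same_connected_component. Qed.

(** The image of a small interval around an angle of J is connected and misses the
closed set E, hence lies in the component J. *)
Lemma complementary_arc_open J : complementary_arcs E J -> open (turn @^-1` J).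
Proof.
move=> EJ; rewrite openE => t Jt; rewrite /interior/=.
have : open (turn @^-1` (~` E)).
  by apply: open_comp; [move=> ? _; exact: turn_continuous|exact: closed_openC].
rewrite openE => /(_ t (complementary_arc_sub EJ Jt)).
rewrite /interior/= -nbhs_ballE => -[e /= e0 teE].
apply/nbhs_ballP; exists e => // s ts /=.
rewrite (complementary_arcE EJ Jt).
apply: (@connected_component_max _ _ (turn @` ball t e)).
- by exists t => //; exact: ballxx.
- by move=> z [u tu <-]; exact: teE.
- apply: connected_continuous_connected.
    by apply/connected_intervalP; rewrite ball_itv; exact: interval_is_interval.
  by apply: continuous_subspaceT => u; exact: turn_continuous.
- by exists s.
Qed.

Lemma measurable_unwrap (A : set (circle R)) :
  open (turn @^-1` A) -> measurable (unwrap A).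
Proof.
move=> oA; rewrite (_ : unwrap A = `[0, 1[%classic `&` turn @^-1` A).
  by apply: measurableI => //; exact: open_measurable.
by apply/seteqP; split=> t; rewrite /unwrap/= in_itv/=.
Qed.

Lemma measurable_unwrap_arc J : complementary_arcs E J -> measurable (unwrap J).
Proof. by move=> EJ; apply: measurable_unwrap; exact: complementary_arc_open. Qed.

Lemma arc_length_le1 J : complementary_arcs E J -> (arc_length J <= 1)%E.
Proof.
move=> EJ; have -> : (1 = leb `[0%R, 1%R[)%E.
  by rewrite lebesgue_measure_itv/= lte_fin ltr01 sube0.
rewrite arc_lengthE; apply: le_measure; rewrite ?inE//.
  exact: measurable_unwrap_arc.
by move=> t [t01 _]; rewrite /= in_itv.
Qed.

Lemma arc_length_fin_num J : complementary_arcs E J ->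
  arc_length J \is a fin_num.
Proof.
move=> EJ; apply/fin_numPlt; rewrite (lt_le_trans (ltNyr 0))//=.
by rewrite (le_lt_trans (arc_length_le1 EJ))// ltry.
Qed.

Lemma unwrap_arc_trivIset : trivIset (complementary_arcs E) unwrap.
Proof.
move=> J J' EJ EJ' [t [[_ Jt] [_ J't]]].
by rewrite (complementary_arcE EJ Jt) (complementary_arcE EJ' J't).
Qed.

Lemma esum_arc_length_le1 : (\esum_(J in complementary_arcs E) arc_length J <= 1)%E.
Proof.
apply: ge_ereal_sup => _ [X [finX XE] <-].
under eq_fsbigr do rewrite arc_lengthE.
rewrite -measure_fin_bigcup//; last 2 first.
- by move=> J J' /XE EJ /XE EJ'; exact: unwrap_arc_trivIset.
- by move=> J /XE; exact: measurable_unwrap_arc.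
have -> : (1 = leb `[0%R, 1%R[)%E.
  by rewrite lebesgue_measure_itv/= lte_fin ltr01 sube0.
apply: le_measure; rewrite ?inE//.
  by apply: fin_bigcup_measurable => // J /XE; exact: measurable_unwrap_arc.
by move=> t [J _ [t01 _]]; rewrite /= in_itv.
Qed.

(** Disjoint arcs contain distinct rational angles. *)
Lemma complementary_arcs_injection :
  exists f : set (circle R) -> nat, set_inj (complementary_arcs E) f.
Proof.
have rat_in J : exists q : rat, complementary_arcs E J -> J (turn (ratr q)).
  have [EJ|nEJ] := pselect (complementary_arcs E J); last by exists 0.
  have : turn @^-1` J !=set0.
    have [z Ez Jz] := EJ; have [t _ tz] := turn_surj z.
    exists t; rewrite /preimage/= tz; rewrite -Jz; exact: connected_component_refl.
  move=> /(@dense_rat R)/(_ (complementary_arc_open EJ)) [x [Jx [q _ qx]]].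
  by exists q => _; rewrite qx.
have [q qP] := choice rat_in.
exists (pickle \o q) => J J' /set_mem EJ /set_mem EJ' /(pcan_inj pickleK) qJJ'.
rewrite (complementary_arcE EJ (qP _ EJ)) (complementary_arcE EJ' (qP _ EJ')).
by rewrite qJJ'.
Qed.

(** Countable subadditivity is applied to the sequence F obtained by placing the
trace of each arc at its index, all other terms being empty; repetitions would
make the series too large, hence an injection rather than an enumeration. *)
Lemma lebesgue_le_esum_arcs (B : set R) : arc_length E = 0%E ->
  measurable B -> B `<=` `[0, 1[ ->
  (leb B <= \esum_(J in complementary_arcs E) leb (B `&` unwrap J))%E.
Proof.
move=> E0 mB B01; have [f f_inj] := complementary_arcs_injection.
pose F i := \bigcup_(J in complementary_arcs E `&` f @^-1` [set i])
  (B `&` unwrap J).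
have FE J : complementary_arcs E J -> F (f J) = B `&` unwrap J.
  move=> EJ; apply/seteqP; split=> t; last by move=> ?; exists J.
  by move=> [J' [EJ' /= fJJ']]; rewrite (f_inj J' J _ _ fJJ') ?inE.
have F0 i : ~ (f @` complementary_arcs E) i -> F i = set0.
  move=> nfi; rewrite -subset0 => t [J [EJ fJ] _]; apply: nfi.
  by exists J.
have mF i : measurable (F i).
  have [[J EJ <-]|/F0 ->//] := pselect ((f @` complementary_arcs E) i).
  by rewrite FE//; apply: measurableI => //; exact: measurable_unwrap_arc.
have mE : measurable (unwrap E).
  rewrite (_ : unwrap E = `[0, 1[%classic `\` (turn @^-1` (~` E))).
    apply: measurableD => //; apply: open_measurable.
    by apply: open_comp; [move=> ? _; exact: turn_continuous|exact: closed_openC].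
  by apply/seteqP; split=> t; rewrite /unwrap/= in_itv/= notK.
have -> : \esum_(J in complementary_arcs E) leb (B `&` unwrap J) =
    (\sum_(i <oo) leb (F i))%E.
  rewrite nneseries_esumT; last by move=> i; exact: measure_ge0.
  rewrite (eq_esum (b := leb \o F \o f)); last by move=> J EJ /=; rewrite FE.
  rewrite -(@esum_image _ _ _ _ f (leb \o F))// esum_mkcond.
  apply: eq_esum => i _; case: ifPn => // /negP.
  by rewrite inE => /F0 /= ->; rewrite measure0.
have mUF : measurable (\bigcup_i F i) by exact: bigcupT_measurable.
apply: (@le_trans _ _ (leb (unwrap E `|` \bigcup_i F i))).
  apply: le_measure; rewrite ?inE//; first exact: measurableU.
  move=> t Bt; have t01 := B01 _ Bt; rewrite /= in_itv/= in t01.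
  have [Et|nEt] := pselect (E (turn t)); [by left|right].
  pose J := connected_component (~` E) (turn t).
  have EJ : complementary_arcs E J by exists (turn t).
  exists (f J) => //=; rewrite FE//; split=> //; split=> //.
  exact: connected_component_refl.
apply: le_trans (measureU2 _ _ _) _ => //.
rewrite -[leRHS]add0e; apply: leeD; last exact: measure_sigma_subadditive.
have le0 : (arc_length E <= 0)%E by rewrite E0.
exact: le0.
Qed.

End ComplementaryArcs.

(** * Dyadic arcs meeting a closed set of zero length *)

Section CountingDyadicArcs.
Context {R : realType} (E : set (circle R)).
Context (E_closed : closed E).

Local Notation leb := (@lebesgue_measure R).

Definition meets (m k : nat) : bool :=
  `[< exists2 z, @dyadic_arc R m k z & E z >].

Definition nb_meets (m : nat) : nat := \sum_(k < 2 ^ m | meets m k) 1.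

Lemma dyadic_itv_disjoint m j k t :
  @dyadic_itv R m j t -> dyadic_itv m k t -> j = k.
Proof.
move=> tj tk; apply/eqP; case: (ltngtP j k) => // jk.
  by have := dyadic_itv_lt jk tj tk; rewrite ltxx.
by have := dyadic_itv_lt jk tk tj; rewrite ltxx.
Qed.

Lemma meets_point m k : (k < 2 ^ m)%N -> meets m k ->
  exists2 q, dyadic_itv m k q & E (turn q).
Proof.
move=> km /asboolP[z]; rewrite dyadic_arcE => -[q kq <-] Eq.
by exists q.
Qed.

Lemma sum_meets_both_le2 m J : complementary_arcs E J ->
  (\sum_(k < 2 ^ m | meets m k && `[< dyadic_itv m k `&` unwrap J !=set0 >]) 1
   <= 2)%N.
Proof.
move=> EJ; rewrite sum1_card leqNgt.
apply/card_gt2P => -[x [y [z [[xS yS zS] [xy yz zx]]]]].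
set S : {pred 'I_(2 ^ m)} := (X in x \in X) in xS yS zS.
have pq k : exists pq : R * R, (k < 2 ^ m)%N -> meets m k ->
    `[< dyadic_itv m k `&` unwrap J !=set0 >] ->
    [/\ dyadic_itv m k pq.1, J (turn pq.1), dyadic_itv m k pq.2 & ~ J (turn pq.2)].
  have [km|] := boolP (k < 2 ^ m)%N; last by exists (0, 0).
  have [Ek|] := boolP (meets m k); last by exists (0, 0).
  have [/asboolP[p [kp [_ Jp]]]|] := boolP `[< dyadic_itv m k `&` unwrap J !=set0 >];
    last by exists (0, 0).
  have [q kq Eq] := meets_point km Ek.
  by exists (p, q) => _ _ _; split=> // /(complementary_arc_sub EJ).
(* f k is a pair of points of the k-th interval, in J and in E. *)
have [f fP] := choice pq.
have SP u : u \in S -> meets m u /\ `[< dyadic_itv m u `&` unwrap J !=set0 >].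
  by rewrite unfold_in => /andP.
have no_three (u v w : 'I_(2 ^ m)) : u \in S -> v \in S -> w \in S ->
    (u < v)%N -> (v < w)%N -> False.
  move=> uS vS wS uv vw.
  apply: (@no_three_dyadic_arcs R m J u v w (fst \o f) (snd \o f)) => //.
    exact: complementary_arc_connected EJ.
  move=> k; rewrite !inE => /or3P[] /eqP ->; apply: fP => //.
  - by have [] := SP u uS.
  - by have [] := SP u uS.
  - by have [] := SP v vS.
  - by have [] := SP v vS.
  - by have [] := SP w wS.
  - by have [] := SP w wS.
have lt_neq (u v : 'I_(2 ^ m)) : u != v -> (u < v)%N \/ (v < u)%N.
  by rewrite -(inj_eq val_inj)/= neq_ltn => /orP.
have [/lt_neq xy' /lt_neq yz' /lt_neq zx'] : [/\ x != y, y != z & z != x] by [].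
case: xy' yz' zx' => xy' [] yz' [] zx'.
- by move: (ltn_trans (ltn_trans xy' yz') zx'); rewrite ltnn.
- exact: no_three xS yS zS xy' yz'.
- exact: no_three zS xS yS zx' xy'.
- exact: no_three xS zS yS zx' yz'.
- exact: no_three yS zS xS yz' zx'.
- exact: no_three yS xS zS xy' zx'.
- exact: no_three zS yS xS yz' xy'.
- by move: (ltn_trans (ltn_trans zx' yz') xy'); rewrite ltnn.
Qed.

Lemma sum_restrict_support (I : finType) (P Q : pred I) (F : I -> \bar R) :
  (forall i, P i -> ~~ Q i -> F i = 0%E) ->
  (\sum_(i | P i) F i = \sum_(i | P i && Q i) F i)%E.
Proof.
move=> F0; rewrite (bigID Q)/= [X in (_ + X)%E]big1 ?adde0// => i /andP[].
exact: F0.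
Qed.

(** The first bound holds because the traces of the dyadic intervals on J are
disjoint, the second because at most two of those that meet E have a trace. *)
Lemma meets_arc_le m J : complementary_arcs E J ->
  (\sum_(k < 2 ^ m | meets m k) leb (dyadic_itv m k `&` unwrap J)
   <= (Num.min (fine (arc_length J)) (2 * 2 ^- m))%:E)%E.
Proof.
move=> EJ; have mJ := measurable_unwrap_arc E_closed EJ.
have mI k : measurable (@dyadic_itv R m k `&` unwrap J).
  by apply: measurableI => //; exact: measurable_itv.
rewrite EFin_min le_min; apply/andP; split.
  rewrite fineK ?(arc_length_fin_num E_closed EJ)//.
  pose F k := if meets m k then @dyadic_itv R m k `&` unwrap J else set0.
  have mF k : measurable (F k) by rewrite /F; case: ifP.
  have tF : trivIset setT F.
    move=> j k _ _ [t []]; rewrite /F; case: ifP => // _ [jt _].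
    case: ifP => // _ [kt _]; exact: dyadic_itv_disjoint jt kt.
  rewrite big_mkcond/=.
  rewrite (eq_bigr (fun k : 'I_(2 ^ m) => leb (F k))); last first.
    by move=> k _; rewrite /F; case: ifP => //; rewrite measure0.
  rewrite -measure_bigsetU// arc_lengthE; apply: le_measure; rewrite ?inE//.
    by apply: bigsetU_measurable => k _; exact: mF.
  by rewrite -bigcup_mkord => t [k _]; rewrite /F; case: ifP => // _ [].
rewrite (@sum_restrict_support _ _
  (fun k : 'I_(2 ^ m) => `[< dyadic_itv m k `&` unwrap J !=set0 >])).
  apply: (@le_trans _ _ (\sum_(k < 2 ^ m | meets m k &&
      `[< dyadic_itv m k `&` unwrap J !=set0 >]) (2 ^- m)%:E)%E).
    apply: lee_sum => k _; rewrite -(lebesgue_dyadic_itv m k).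
    apply: le_measure; last exact: subIsetl.
      by rewrite inE; exact: mI.
    by rewrite inE; exact: measurable_itv.
  rewrite sumEFin lee_fin sumr_const -sum1_card -[leLHS]mulr_natl.
  rewrite ler_pM2r ?invr_gt0 ?exprn_gt0// ler_nat.
  exact: sum_meets_both_le2.
move=> k _ /asboolPn/nonemptyPn ->; exact: measure0.
Qed.

(** The discrete form of the estimate of the length of a neighbourhood of E by
the sum over J of min(|J|, 2 2^-m).  Zero length of E is what lets the
complementary arcs carry the whole length of the dyadic arcs. *)
Lemma nb_meets_le m : arc_length E = 0%E ->
  (((nb_meets m)%:R * 2 ^- m)%:E <=
   \esum_(J in complementary_arcs E)
     (Num.min (fine (arc_length J)) (2 * 2 ^- m))%:E)%E.
Proof.
move=> E0.
apply: (@le_trans _ _ (\sum_(k < 2 ^ m | meets m k)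
    \esum_(J in complementary_arcs E) leb (dyadic_itv m k `&` unwrap J))%E).
  rewrite /nb_meets natr_sum mulr_suml -sumEFin; apply: lee_sum => k _.
  rewrite mul1r -(lebesgue_dyadic_itv m k); apply: lebesgue_le_esum_arcs => //.
    exact: measurable_itv.
  by move=> t /(dyadic_itv_sub01 (ltn_ord k)); rewrite /= in_itv.
rewrite -esum_sum; last by move=> J k _ _; exact: measure_ge0.
by apply: le_esum => J EJ; exact: meets_arc_le.
Qed.

End CountingDyadicArcs.

(** * Regular gauge functions *)

Section GaugeTheory.
Context (R : realType) (phi lambda : R -> R).
Context (phi_gauge : regular_gauge phi lambda).

(** The integral phi1 is finite on ]0, 1] by G1, see [phi1_fin_num]. *)
Definition rphi1 (t : R) : R := fine (phi1 lambda t).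

Lemma gauge_inv_lambda_ge0 (s : R) :
  s \in `]0, 1] -> (0 <= ((lambda s)%:E)^-1)%E.
Proof.
rewrite in_itv /= => s01.
have := gauge_lambda_ge0 phi_gauge s01; rewrite le_eqVlt => /predU1P[<-|l0].
  by rewrite inve0.
by rewrite inver gt_eqF// lee_fin invr_ge0 ltW.
Qed.

Lemma gauge_inv_lambda_measurable :
  measurable_fun (`]0, 1] : set R) (fun s : R => ((lambda s)%:E)^-1 : \bar R)%E.
Proof.
have ml := gauge_lambda_measurable phi_gauge.
(* The power of exponent -1 is measurable and agrees with the inverse at the
   positive values of lambda. *)
pose f s := if lambda s == 0 then +oo%E else (lambda s `^ (-1))%:E.
apply: (@eq_measurable_fun _ _ _ _ _ f).
  move=> s; rewrite inE /= in_itv /= /f => s01; rewrite inver; case: ifPn => // l0.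
  by rewrite powR_inv1// (gauge_lambda_ge0 phi_gauge).
apply: measurable_fun_if => //.
- by apply: measurable_fun_eqr => //; exact: measurable_cst.
- apply/measurable_EFinP.
  apply: (@measurableT_comp _ _ _ _ _ _ (@powR R ^~ (-1)) _ lambda).
    exact: measurable_powR.
  by apply: measurable_funS ml => // s [].
Qed.

Lemma int_inv_ge0 (a b : R) : 0 <= a -> b <= 1 -> (0 <= int_inv lambda a b)%E.
Proof.
move=> a0 b1; apply: integral_ge0 => s /=; rewrite in_itv /= => /andP[as_ sb].
apply: gauge_inv_lambda_ge0.
by rewrite in_itv /= (le_lt_trans a0 as_) (le_trans sb b1).
Qed.

Lemma phi1_split (a b : R) : 0 <= a -> a <= b -> b <= 1 ->
  phi1 lambda a = (int_inv lambda a b + phi1 lambda b)%E.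
Proof.
move=> a0 ab b1; rewrite /phi1 /int_inv.
rewrite (@itv_bndbnd_setU _ _ _ (BRight b)) ?bnd_simp//.
have sub : (`]a, b]%classic `|` `]b, 1]%classic : set R) `<=` `]0, 1]%classic.
  by rewrite -itv_bndbnd_setU ?bnd_simp//; apply: subset_itvr; rewrite bnd_simp.
rewrite ge0_integral_setU//=.
- exact: measurable_funS gauge_inv_lambda_measurable.
- by move=> s /sub; exact: gauge_inv_lambda_ge0.
- apply/disj_setPS => s /= []; rewrite !in_itv /= => /andP[_ sb] /andP[bs _].
  by move: (le_lt_trans sb bs); rewrite ltxx.
Qed.

(** An infinite integral would make phi t infinite, by G1. *)
Lemma phi1_fin_num (t : R) : 0 < t <= 1 -> phi1 lambda t \is a fin_num.
Proof.
move=> /andP[t0 t1].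
have := gauge_G1 phi_gauge (t := t); rewrite (ltW t0) t1 => /(_ isT).
have : (0 <= phi1 lambda t)%E by apply: int_inv_ge0 => //; exact: ltW.
by case: (phi1 lambda t) => //= _; rewrite mulry gtr0_sg// mul1e.
Qed.

Lemma rphi1E (t : R) : 0 < t <= 1 -> (rphi1 t)%:E = phi1 lambda t.
Proof. by move=> t01; rewrite /rphi1 fineK// phi1_fin_num. Qed.

Lemma gaugeE (t : R) : 0 < t <= 1 -> phi t = t * rphi1 t.
Proof.
move=> t01; have /andP[t0 t1] := t01; apply: EFin_inj.
by rewrite (gauge_G1 phi_gauge) ?(ltW t0)// EFinM rphi1E.
Qed.

Lemma rphi1_ge0 (t : R) : 0 < t <= 1 -> 0 <= rphi1 t.
Proof.
by move=> /andP[t0 t1]; apply: fine_ge0; apply: int_inv_ge0 => //; exact: ltW.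
Qed.

Lemma rphi1_antitone (s t : R) : 0 < s -> s <= t -> t <= 1 ->
  rphi1 t <= rphi1 s.
Proof.
move=> s0 st t1; rewrite -lee_fin !rphi1E ?s0 ?(le_trans st)//; last first.
  by rewrite t1 (lt_le_trans s0).
by rewrite (@phi1_split s t) ?(ltW s0)// leeDr// int_inv_ge0// ltW.
Qed.

(** The value at half the argument is the second term of the series in G3, which
gives the first bound. *)
Lemma gauge_dyadic_bounds : exists2 C0 : R, 0 < C0 &
  (forall t : R, 0 <= t <= 1 / 2 -> phi (t / 2) <= C0 * phi t) /\
  (forall (t : R) m, 0 <= t <= 1 / 2 ->
     \sum_(0 <= k < m) phi (2 ^- k * t) <= C0 * phi t).
Proof.
have [C0 C00 G3] := gauge_G3 phi_gauge.
have main (t : R) m : 0 <= t <= 1 / 2 ->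
    \sum_(0 <= k < m) phi (2 ^- k * t) <= C0 * phi t.
  move=> t2; rewrite -lee_fin -sumEFin; apply: le_trans (G3 t t2).
  apply: nneseries_lim_ge => k _ _; rewrite lee_fin.
  apply: (gauge_ge0 phi_gauge); case/andP: t2 => t0 t2.
  rewrite mulr_ge0//= -[leRHS]mul1r ler_pM//; last lra.
  by rewrite invf_le1 ?exprn_ege1// ?ler1n// exprn_gt0.
exists C0 => //; split=> // t t2; have := main t 2%N t2.
rewrite big_nat_recr//= big_nat1 expr0 expr1 invr1 mul1r mulrC.
apply: le_trans; rewrite lerDr (gauge_ge0 phi_gauge)//; lra.
Qed.

End GaugeTheory.

(** * Sums over the scales of a grid *)

Section ArcSums.
Context (R : realType) (phi lambda : R -> R) (n : nat -> nat).
Context (phi_gauge : regular_gauge phi lambda).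
Context (n_grid : dyadic_grid lambda n).

Local Notation scale j := (2 ^- n j : R).
Local Notation f1 := (rphi1 lambda).

Lemma pow2_in01 m : 0 < (2 ^- m : R) <= 1.
Proof. by rewrite invr_gt0 exprn_gt0//= invf_le1 ?exprn_ege1 ?ler1n ?exprn_gt0. Qed.

(** phi1 at scale j + 1 is phi1 at scale j plus the integral between the two
scales, which the grid condition bounds below. *)
Lemma grid_growth : exists2 c : R, 0 < c &
  forall j, (1 <= j)%N -> (1 + c) * f1 (scale j) <= f1 (scale j.+1).
Proof.
have [_ n_incr [c [c' [c0 _ n_c]]]] := n_grid.
exists c => // j j1; rewrite -lee_fin EFinM !(rphi1E phi_gauge) ?pow2_in01//.
rewrite (@phi1_split _ _ _ phi_gauge (scale j.+1) (scale j)); last 3 first.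
- by have /andP[/ltW] := pow2_in01 (n j.+1).
- by rewrite lef_pV2 ?posrE ?exprn_gt0// ler_eXn2l ?ltr1n// ltnW// n_incr.
- by have /andP[] := pow2_in01 (n j).
rewrite EFinD ge0_muleDl// ?lee_fin ?(ltW c0)// mul1e addeC leeD2r//.
by have /andP[] := n_c j j1.
Qed.

(** Summation of a sequence growing at least geometrically, in order of
decreasing scale: the sum is comparable to its last term. *)
Lemma coarse_sum : exists2 K : R, 0 < K & forall l m, 0 < l <= 1 ->
  \sum_(1 <= j < m | l <= scale j) f1 (scale j) <= K * f1 l.
Proof.
have [c c0 growth] := grid_growth.
have K0 : 0 < 1 + c^-1 by rewrite addr_gt0 ?invr_gt0.
(* K = 1 + 1/c is the fixed point of K = K / (1 + c) + 1. *)
exists (1 + c^-1) => // l m l01.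
have f1l j : l <= scale j -> f1 (scale j) <= f1 l.
  move=> lj; apply: (rphi1_antitone phi_gauge) => //; first by case/andP: l01.
  by case/andP: (pow2_in01 (n j)).
have scale_incr j : (1 <= j)%N -> scale j.+1 <= scale j.
  have [_ n_incr _] := n_grid => j1.
  by rewrite lef_pV2 ?posrE ?exprn_gt0// ler_eXn2l ?ltr1n// ltnW// n_incr.
(* The sum is bounded by its last term as long as the scales exceed l, and
   then stops growing. *)
suff [S1 S2] : (l <= scale m.+1 -> \sum_(1 <= j < m.+2 | l <= scale j) f1 (scale j)
      <= (1 + c^-1) * f1 (scale m.+1)) /\
    \sum_(1 <= j < m.+1 | l <= scale j) f1 (scale j) <= (1 + c^-1) * f1 l.
  apply: le_trans S2; case: m {S1} => [|m]; first by rewrite !big_geq.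
  rewrite [leRHS]big_mkcond big_nat_recr//= -big_mkcond/= lerDl.
  by case: ifP => // _; rewrite (rphi1_ge0 phi_gauge)// pow2_in01.
elim: m => [|m [IH1 IH2]].
  rewrite (big_geq (leqnn 1)) mulr_ge0 ?(rphi1_ge0 phi_gauge) ?(ltW K0)//.
  split=> // l1; rewrite big_mkcond big_nat1 l1 ler_peMl//.
    by rewrite (rphi1_ge0 phi_gauge)// pow2_in01.
  by rewrite lerDl invr_ge0 ltW.
have S2 : \sum_(1 <= j < m.+2 | l <= scale j) f1 (scale j) <= (1 + c^-1) * f1 l.
  case: (leP l (scale m.+1)) => [lm|ml].
    by apply: le_trans (IH1 lm) _; rewrite ler_pM2l// f1l.
  rewrite big_mkcond big_nat_recr//= -big_mkcond/= (lt_geF ml) addr0.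
  exact: IH2.
split=> // lm2; have lm1 := le_trans lm2 (scale_incr m.+1 isT).
rewrite big_mkcond big_nat_recr//= -big_mkcond/= lm2.
have -> : (1 + c^-1) * f1 (scale m.+2) =
    c^-1 * f1 (scale m.+2) + f1 (scale m.+2) by ring.
rewrite lerD2r; apply: le_trans (IH1 lm1) _.
have -> : 1 + c^-1 = c^-1 * (1 + c) by field; rewrite gt_eqF.
by rewrite -mulrA ler_pM2l ?invr_gt0// growth.
Qed.

(** The generations n j are distinct, so the sum is part of that of phi(2^-k) over
k >= i, where i is the first exponent with 2^-i < l; G3 bounds the latter by
phi(2^-i).  As l / 2 <= 2^-i < l, this is comparable to phi(l) when l <= 1 / 2.
When l > 1 / 2, the value phi(l) may be arbitrarily small, and the term in K'
takes over. *)
Lemma fine_sum : exists K K' : R, [/\ 0 < K, 0 <= K' &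
  forall l m, 0 < l <= 1 ->
  \sum_(1 <= j < m | scale j < l) phi (scale j) <= K * phi l + K' * l].
Proof.
have [n_pos n_incr _] := n_grid.
have [C0 C00 [half G3]] := gauge_dyadic_bounds phi_gauge.
have phi_pow_ge0 i : 0 <= phi (2 ^- i).
  by apply: (gauge_ge0 phi_gauge); case/andP: (pow2_in01 i) => /ltW -> ->.
(* phi increases by at most a factor 2 over an octave, as phi1 decreases. *)
have dec (s t : R) : 0 < s -> s <= t -> t <= 2 * s -> t <= 1 -> phi t <= 2 * phi s.
  move=> s0 st ts t1; rewrite !(gaugeE phi_gauge) ?s0 ?(lt_le_trans s0)//; last first.
    by rewrite (le_trans st).
  rewrite mulrA ler_pM//.
  - by rewrite ltW// (lt_le_trans s0).
  - by rewrite (rphi1_ge0 phi_gauge)// t1 (lt_le_trans s0).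
  - exact: (rphi1_antitone phi_gauge).
exists (2 * C0 ^+ 2), (2 * C0 * phi (2 ^- 1)); split.
- by rewrite mulr_gt0// exprn_gt0.
- by rewrite !mulr_ge0// ltW.
move=> l m l01; have [l0 l1] := andP l01.
have ex : exists i, 2 ^- i < l.
  exists (Num.bound l^-1); rewrite invf_plt ?posrE ?exprn_gt0//.
  have l'0 : 0 <= l^-1 by rewrite invr_ge0 ltW.
  apply: lt_trans (archi_boundP l'0) _.
  by rewrite -natrX ltr_nat ltn_expl.
have [i il imin] := ex_minnP ex.
have i0 : (0 < i)%N.
  by case: i il {imin} => //; rewrite expr0 invr1 => /lt_geF; rewrite l1.
have il2 : l <= 2 ^- i * 2.
  rewrite leNgt; apply/negP => lt2l.
  have pi : 2 ^- i.-1 = 2 ^- i * 2 :> R.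
    by rewrite -[in RHS](prednK i0) exprS invfM mulrAC mulVf ?mul1r// pnatr_eq0.
  have := imin i.-1; rewrite pi => /(_ lt2l).
  by rewrite -[leqLHS](prednK i0) ltnn.
have phi_i : phi (2 ^- i) <= 2 * C0 * phi l + 2 * phi (2 ^- 1) * l.
  case: (leP l (1 / 2)) => [l2|l2].
    apply: (@le_trans _ _ (2 * phi (l / 2))).
      by apply: dec; [lra|lra|lra|have /andP[] := pow2_in01 i].
    apply: (@le_trans _ _ (2 * C0 * phi l)).
      by rewrite -mulrA ler_pM2l// half// l2 ltW.
    by rewrite lerDl mulr_ge0// ?mulr_ge0// ltW.
  have -> : i = 1%N.
    by apply/eqP; rewrite eqn_leq i0 andbT; apply: imin; rewrite expr1; lra.
  have p0 := phi_pow_ge0 1%N.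
  have pl0 : 0 <= phi l by apply: (gauge_ge0 phi_gauge); rewrite l1 ltW.
  rewrite expr1 in p0 *; apply: (@le_trans _ _ (2 * phi 2^-1 * l)).
    by rewrite mulrAC -[leLHS]mul1r ler_wpM2r//; lra.
  by rewrite lerDr mulr_ge0// mulr_ge0// ltW.
have sub : \sum_(1 <= j < m | scale j < l) phi (scale j) <=
   \sum_(i <= k < n m) phi (2 ^- k).
  case: m => [|m]; first by rewrite big_geq// sumr_ge0.
  elim: m => [|m IH]; first by rewrite big_geq// sumr_ge0.
  rewrite big_mkcond big_nat_recr//= -big_mkcond/=.
  have n12 := n_incr m.+1 isT.
  case: ifPn => [ml|_]; last first.
    rewrite addr0; apply: le_trans IH _.
    case: (leqP i (n m.+1)) => im; last by rewrite [leLHS]big_geq ?(ltnW im)// sumr_ge0.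
    by rewrite [leRHS](big_cat_nat im (ltnW n12))/= lerDl sumr_ge0.
  have im : (i <= n m.+1)%N by exact: imin.
  rewrite [leRHS](big_cat_nat (leq_trans im (leqnSn _)) n12)/= big_nat_recr//=.
  by rewrite -addrA lerD// lerDl sumr_ge0.
apply: le_trans sub _.
have -> : \sum_(i <= k < n m) phi (2 ^- k) =
    \sum_(0 <= k < n m - i) phi (2 ^- k * 2 ^- i).
  rewrite -{1}[i]add0n big_addn; apply: eq_bigr => k _.
  by rewrite exprD invfM.
apply: le_trans (G3 _ _ _) _.
  have := pow2_in01 i; rewrite -(prednK i0) exprS invfM.
  by have := pow2_in01 i.-1; lra.
have -> : 2 * C0 ^+ 2 * phi l + 2 * C0 * phi (2 ^- 1) * l =
  C0 * (2 * C0 * phi l + 2 * phi (2 ^- 1) * l) by ring.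
by rewrite ler_pM2l.
Qed.

(** The contribution of a complementary arc of length l to the series of the
N(n j) phi(2^-(n j)): at the scales 2^-(n j) >= l the minimum is at most l, and at
the finer ones it is at most twice the scale. *)
Lemma arc_sum : exists K K' : R, [/\ 0 <= K, 0 <= K' &
  forall l m, 0 <= l <= 1 ->
  \sum_(1 <= j < m) Num.min l (2 * scale j) * f1 (scale j) <= K * phi l + K' * l].
Proof.
have [K1 K10 coarse] := coarse_sum.
have [K2 [K' [K20 K'0 fine]]] := fine_sum.
exists (K1 + 2 * K2), (2 * K'); split.
- by rewrite addr_ge0 ?mulr_ge0// ltW.
- by rewrite mulr_ge0.
move=> l m /andP[]; rewrite le_eqVlt => /predU1P[<-|l0] l1.
  rewrite big1 => [|j _].
    rewrite mulr0 addr0 mulr_ge0 ?addr_ge0 ?mulr_ge0 ?(ltW K10) ?(ltW K20)//.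
    by apply: (gauge_ge0 phi_gauge); rewrite lexx ler01.
  by rewrite min_l ?mul0r// mulr_ge0//; case/andP: (pow2_in01 (n j)) => /ltW.
have l01 : 0 < l <= 1 by rewrite l0.
rewrite (bigID (fun j => l <= scale j))/=.
have -> : (K1 + 2 * K2) * phi l + 2 * K' * l =
   l * (K1 * f1 l) + 2 * (K2 * phi l + K' * l).
  by rewrite [in LHS]mulrDl {1}(gaugeE phi_gauge l01); ring.
apply: lerD.
  apply: (@le_trans _ _ (l * \sum_(1 <= j < m | l <= scale j) f1 (scale j))).
    rewrite mulr_sumr; apply: ler_sum => j _.
    by rewrite ler_wpM2r ?ge_min ?lexx// (rphi1_ge0 phi_gauge)// pow2_in01.
  by rewrite ler_pM2l// coarse.
under eq_bigl do rewrite -ltNge.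
apply: (@le_trans _ _ (2 * \sum_(1 <= j < m | scale j < l) phi (scale j))).
  rewrite mulr_sumr; apply: ler_sum => j _.
  rewrite (gaugeE phi_gauge (pow2_in01 _)) mulrA.
  by rewrite ler_wpM2r ?ge_min ?lexx ?orbT// (rphi1_ge0 phi_gauge)// pow2_in01.
by rewrite ler_pM2l// fine.
Qed.

End ArcSums.

(** * Measures and Beurling-Carleson sets *)

Section MassOfBeurlingCarlesonSets.
Context (R : realType).

Lemma esumZl_ge0 (T : choiceType) (I : set T) (a : T -> \bar R) (c : R) :
  0 <= c -> (forall i, I i -> (0 <= a i)%E) ->
  (\esum_(i in I) (c%:E * a i) = c%:E * \esum_(i in I) a i)%E.
Proof.
move=> c0 a_ge0.
(* One inequality holds for every factor; the other is the same one for the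
   inverse factor. *)
have sumZ_le (d : R) (b : T -> \bar R) : 0 <= d -> (forall i, (0 <= b i)%E) ->
    (\esum_(i in I) (d%:E * b i) <= d%:E * \esum_(i in I) b i)%E.
  move=> d0 b0; apply: ge_ereal_sup => _ [X [finX XI] <-].
  rewrite -ge0_mule_fsumr//; apply: lee_wpmul2l; rewrite ?lee_fin//.
  by apply: esum_ge; exists X.
have aE i : I i -> a i = `|a i|%E by move=> Ii; rewrite gee0_abs// a_ge0.
rewrite (eq_esum aE) (eq_esum (b := fun i => c%:E * `|a i|)%E); last first.
  by move=> i Ii; rewrite -aE.
have [->|c_neq0] := eqVneq c 0.
  by rewrite mul0e esum1// => i _; rewrite mul0e.
have c_gt0 : 0 < c by rewrite lt_neqAle eq_sym c_neq0.
apply/eqP; rewrite eq_le sumZ_le//= -lee_pdivlMl//.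
have := sumZ_le c^-1 (fun i => c%:E * `|a i|)%E.
rewrite invr_ge0 c0 (eq_esum (b := abse \o a)); last first.
  by move=> i _; rewrite muleA -EFinM mulVf// mul1e.
by apply=> // i; rewrite mule_ge0// lee_fin.
Qed.

Lemma measure_le_nb_meets (mu : {measure set (circle R) -> \bar R})
    (E : set (circle R)) m (c : R) : closed E ->
  (forall k, (k < 2 ^ m)%N -> (mu (@dyadic_arc R m k) <= c%:E)%E) ->
  (mu E <= (c * (nb_meets E m)%:R)%:E)%E.
Proof.
move=> E_closed mu_c.
pose A k := if meets E m k then @dyadic_arc R m k else set0.
have mA k : measurable (A k).
  by rewrite /A; case: ifP => // _; exact: measurable_dyadic_arc.
have mE : measurable E.
  rewrite -[E]setCK; apply: measurableC; apply: sub_sigma_algebra.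
  exact: closed_openC.
have E_sub : E `<=` \big[setU/set0]_(k < 2 ^ m) A k.
  move=> z Ez; have [k km kz] := dyadic_cover m z.
  rewrite -bigcup_mkord; exists k => //; rewrite /A ifT//.
  by apply/asboolP; exists z.
have mu_sub : (mu E <= \sum_(k < 2 ^ m) mu (A k))%E.
  by apply: content_subadditive.
apply: le_trans mu_sub _.
rewrite (eq_bigr (fun k : 'I_(2 ^ m) => if meets E m k
    then mu (@dyadic_arc R m k) else 0%E)); last first.
  by move=> k _; rewrite /A; case: ifP => // _; rewrite measure0.
rewrite -big_mkcond/= /nb_meets natr_sum mulr_sumr -sumEFin.
by apply: lee_sum => k _; rewrite mulr1; exact: mu_c.
Qed.

Context (phi lambda : R -> R) (n : nat -> nat).
Context (phi_gauge : regular_gauge phi lambda).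
Context (n_grid : dyadic_grid lambda n).

(** Insert the bound of [nb_meets_le] in each term and exchange the finite sum
over j with the sum over the arcs, each of which contributes at most
K phi(|J|) + K' |J|. *)
Lemma sum_nb_meets_lty (E : set (circle R)) : beurling_carleson phi E ->
  (\sum_(1 <= j <oo) ((nb_meets E (n j))%:R * phi (2 ^- n j))%:E < +oo)%E.
Proof.
move=> [E_closed E0 phi_sum].
have [K [K' [K0 K'0 arc_K]]] := arc_sum phi_gauge n_grid.
pose S := (K%:E * (\esum_(J in complementary_arcs E)
  (phi (fine (arc_length J)))%:E) + K'%:E)%E.
have l01 J : complementary_arcs E J -> 0 <= fine (arc_length J) <= 1.
  move=> EJ; rewrite fine_ge0 ?measure_ge0//=.
  rewrite -lee_fin fineK ?(arc_length_fin_num E_closed EJ)//.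
  exact: (arc_length_le1 E_closed EJ).
have phi_ge0 j : 0 <= phi (2 ^- n j).
  by apply: (gauge_ge0 phi_gauge); case/andP: (pow2_in01 R (n j)) => /ltW -> ->.
have f1_ge0 j : 0 <= rphi1 lambda (2 ^- n j).
  by rewrite (rphi1_ge0 phi_gauge)// pow2_in01.
have min_ge0 J j : complementary_arcs E J ->
    0 <= Num.min (fine (arc_length J)) (2 * 2 ^- n j).
  by move=> /l01/andP[l0 _]; rewrite le_min l0 mulr_ge0.
have term j : (((nb_meets E (n j))%:R * phi (2 ^- n j))%:E <=
    \esum_(J in complementary_arcs E) (Num.min (fine (arc_length J))
       (2 * 2 ^- n j) * rphi1 lambda (2 ^- n j))%:E)%E.
  rewrite (gaugeE phi_gauge (pow2_in01 _ _)) mulrA mulrC EFinM.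
  apply: (@le_trans _ _ ((rphi1 lambda (2 ^- n j))%:E * \esum_(J in
      complementary_arcs E) (Num.min (fine (arc_length J)) (2 * 2 ^- n j))%:E)%E).
    by apply: lee_wpmul2l; [rewrite lee_fin|exact: nb_meets_le].
  rewrite -esumZl_ge0// => [|J EJ]; last by rewrite lee_fin min_ge0.
  by apply: le_esum => J EJ; rewrite -EFinM mulrC.
have bound M : (\sum_(1 <= j < M) ((nb_meets E (n j))%:R * phi (2 ^- n j))%:E <= S)%E.
  apply: le_trans (lee_sum _ (fun j _ => term j)) _.
  rewrite -esum_sum => [|J j EJ _]; last by rewrite lee_fin mulr_ge0// min_ge0.
  apply: (@le_trans _ _ (\esum_(J in complementary_arcs E)
      (K%:E * (phi (fine (arc_length J)))%:E + K'%:E * arc_length J))%E).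
    apply: le_esum => J EJ; rewrite sumEFin.
    rewrite -(fineK (arc_length_fin_num E_closed EJ)) -!EFinM -EFinD lee_fin.
    exact: arc_K (l01 _ EJ).
  rewrite esumD; last 2 first.
  - by move=> J EJ; rewrite -EFinM lee_fin mulr_ge0// (gauge_ge0 phi_gauge)// l01.
  - by move=> J EJ; rewrite mule_ge0// lee_fin.
  rewrite !esumZl_ge0//; last first.
    by move=> J EJ; rewrite lee_fin (gauge_ge0 phi_gauge)// l01.
  apply: leeD2l; rewrite -[leRHS]mule1; apply: lee_wpmul2l; rewrite ?lee_fin//.
  exact: esum_arc_length_le1.
apply: (@le_lt_trans _ _ S).
  apply: lime_le; last by near=> M; exact: bound.
  by apply: is_cvg_nneseries => j _ _; rewrite lee_fin mulr_ge0.
rewrite /S lte_add_pinfty ?ltry//.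
by rewrite lte_mul_pinfty ?lee_fin.
Unshelve. all: by end_near.
Qed.

End MassOfBeurlingCarlesonSets.

Theorem corollary3p4 (R : realType) (phi lambda : R -> R) (n : nat -> nat)
  (mu : {finite_measure set (circle R) -> \bar R})
  (phi_gauge : regular_gauge phi lambda)
  (n_grid : dyadic_grid lambda n)
  (mu_decomposition : exists2 C : R, 0 < C & forall j0 : nat,
    exists mu_ : nat -> {measure set (circle R) -> \bar R},
      (forall A : set (circle R), measurable A ->
        mu A = (\sum_(1 <= j <oo) mu_ j A)%E) /\
      (forall j, (1 <= j)%N -> forall I, dyadic_arcs (n (j + j0)%N) I ->
        (mu_ j I <= (C * phi (fine (arc_length I)))%:E)%E)) :
  forall E : set (circle R), beurling_carleson phi E -> mu E = 0%E.
Proof.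
move=> E E_bc; have E_closed : closed E by case: E_bc.
have [C C0 decomp] := mu_decomposition.
pose a j := (C * ((nb_meets E (n j))%:R * phi (2 ^- n j)))%:E.
have a_ge0 j : (0 <= a j)%E.
  rewrite lee_fin !mulr_ge0 ?(ltW C0)// (gauge_ge0 phi_gauge)//.
  by case/andP: (pow2_in01 R (n j)) => /ltW -> ->.
have mE : measurable E.
  rewrite -[E]setCK; apply: measurableC; apply: sub_sigma_algebra.
  exact: closed_openC.
(* Only the generations beyond n j0 enter the decomposition with offset j0. *)
have tail j0 : (mu E <= \sum_(j0.+1 <= j <oo) a j)%E.
  have [mu_ [-> // mu_C]] := decomp j0.
  apply: lime_le; first by apply: is_cvg_nneseries => j _ _; exact: measure_ge0.
  near=> N.
  apply: (@le_trans _ _ (\sum_(1 <= j < N) a (j + j0)%N)%E).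
    rewrite big_nat_cond [leRHS]big_nat_cond.
    apply: lee_sum => j; rewrite andbT => /andP[j1 _].
    rewrite /a [_ * phi _]mulrC mulrA; apply: measure_le_nb_meets => // k km.
    have := mu_C j j1 (dyadic_arc (n (j + j0)%N) k).
    rewrite arc_length_dyadic//; apply; by exists k.
  have -> : (\sum_(1 <= j < N) a (j + j0)%N = \sum_(j0.+1 <= j < N + j0) a j)%E.
    by rewrite -[j0.+1]add1n big_addn addnK.
  exact: nneseries_lim_ge.
have a_lty : (\sum_(0 <= j <oo) a j < +oo)%E.
  rewrite (nneseries_split _ 1)// add0n big_nat1 lte_add_pinfty ?ltry//.
  under eq_eseriesr do rewrite /a EFinM.
  rewrite nneseriesZl => [|j _].
    by rewrite lte_mul_pinfty ?lee_fin ?(ltW C0)// (sum_nb_meets_lty phi_gauge n_grid).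
  rewrite lee_fin mulr_ge0// (gauge_ge0 phi_gauge)//.
  by case/andP: (pow2_in01 R (n j)) => /ltW -> ->.
apply/eqP; rewrite eq_le measure_ge0 andbT.
apply: (cvge_ge _ (nneseries_tail_cvg a_lty (fun j _ => a_ge0 j))).
by exists 1%N => // -[|j0]// _; exact: tail.
Unshelve. all: by end_near.
Qed.
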